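(* Let $\mathscr{C}$ be a category with finite limits. Then the bicategory $\mathrm{Spn}\,\mathscr{C}$ of spans in $\mathscr{C}$ is polynomic; that is, the class of all groupoid fibrations in $\mathrm{Spn}\,\mathscr{C}$ is a calibration of $\mathrm{Spn}\,\mathscr{C}$.
   Context: **Spans.** $\mathrm{Spn}\,\mathscr{C}$ has the objects of $\mathscr{C}$; a morphism $(u,S,p):X\to Y$ is a diagram $X\xleftarrow{u}S\xrightarrow{p}Y$ in $\mathscr{C}$; 2-cells are morphisms $S\to S'$ commuting with both legs; composition is by pullback. **Bipullback.** In a bicategory $\mathscr{M}$, a square given by $d:P\to A$, $c:P\to B$, $n:A\to C$, $p:B\to C$ and an invertible 2-cell $\theta:nd\Rightarrow pc$ is a bipullback of $(n,p)$ when, for all objects $K$, the functor $\mathscr{M}(K,P)\to \mathscr{M}(K,n)/_{\mathrm{ps}}\mathscr{M}(K,p)$, $u\mapsto(du,\theta u,cu)$, is an equivalence. Here, for functors $F:\mathscr{X}\to\mathscr{Z}$ and $G:\mathscr{Y}\to\mathscr{Z}$, the category $F/_{\mathrm{ps}}G$ has objects $(x,\alpha,y)$ with $\alpha:Fx\cong Gy$, and morphisms $(s,t):(x,\alpha,y)\to(x',\alpha',y')$ the pairs with $(Gt)\alpha=\alpha'(Fs)$. **Groupoid fibration.** A functor $p:E\to B$ is a groupoid fibration when (i) for all $e\in E$ and $\beta:b\to pe$ in $B$ there exist $\chi:e'\to e$ in $E$ and an isomorphism $b\cong pe'$ whose composite with $p\chi$ is $\beta$; and (ii) every morphism $\chi:e'\to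 e$ of $E$ is cartesian: for all $k\in E$ the square with sides $E(k,\chi):E(k,e')\to E(k,e)$, $B(pk,p\chi):B(pk,pe')\to B(pk,pe)$ and the two functions induced by $p$ is a pullback. A morphism $p:E\to B$ in a bicategory $\mathscr{M}$ is a groupoid fibration when the functor $\mathscr{M}(K,p)$ is one for every object $K$. **Right lifter.** A morphism $n:Y\to Z$ in $\mathscr{M}$ is a right lifter when every $u:K\to Z$ has a right lifting through $n$: a morphism $\mathrm{rif}(n,u):K\to Y$ with a 2-cell $\varpi:n\,\mathrm{rif}(n,u)\Rightarrow u$ such that pasting with $\varpi$ is a bijection between 2-cells $v\Rightarrow\mathrm{rif}(n,u)$ and 2-cells $nv\Rightarrow u$, for all $v:K\to Y$. **Calibration.** A class $\mathscr{P}$ of morphisms (called neat) of a bicategory $\mathscr{M}$ is a calibration when: (P0) all equivalences are neat, and any morphism isomorphic to a neat one is neat; (P1) for all neat $p$, a composite $p\circ q$ is neat if and only if $q$ is neat; (P2) every neat morphism is a groupoid fibration; (P3) every cospan $S\xrightarrow{p}Y\xleftarrow{n}T$ with $n$ a right lifter and $p$ neat has a bipullback with projections $\tilde n:P\to S$ and $\tilde p:P\to T$ in which $\tilde p$ is neat. *)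

(* Defs.v *)
From Stdlib Require Import ssreflect ssrfun List.
From Stdlib Require Import FinFun ProofIrrelevance IndefiniteDescription.

Set Implicit Arguments.
Unset Strict Implicit.
Unset Printing Implicit Defensive.

Declare Scope cat_scope.
Delimit Scope cat_scope with cat.
Local Open Scope cat_scope.

Record category := Category {
  ob :> Type;
  hom : ob -> ob -> Type;
  idm : forall a, hom a a;
  comp : forall a b c, hom b c -> hom a b -> hom a c;
  comp1m : forall a b (f : hom a b), comp (idm b) f = f;
  compm1 : forall a b (f : hom a b), comp f (idm a) = f;
  compA : forall a b c d (h : hom c d) (g : hom b c) (f : hom a b),
    comp h (comp g f) = comp (comp h g) f
}.

Arguments hom {c} _ _ : rename.
Arguments idm {c} a : rename.
Arguments comp {c a b c0} _ _ : rename.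

Notation "a ~> b" := (hom a b) (at level 90, right associativity) : cat_scope.
Notation "g ∘ f" := (comp g f) (at level 40, left associativity) : cat_scope.

Record functor (X Y : category) := Functor {
  fob :> X -> Y;
  fmap : forall a b, (a ~> b) -> (fob a ~> fob b);
  fmap_id : forall a, fmap (idm a) = idm (fob a);
  fmap_comp : forall a b c (g : b ~> c) (f : a ~> b),
    fmap (g ∘ f) = fmap g ∘ fmap f
}.

Arguments fmap {X Y} _ {a b} _.

Record iso (X : category) (a b : X) := Iso {
  fwd :> a ~> b;
  bwd : b ~> a;
  bwd_fwd : bwd ∘ fwd = idm a;
  fwd_bwd : fwd ∘ bwd = idm b
}.

Notation "a ≅ b" := (iso a b) (at level 70, no associativity) : cat_scope.

Definition iso_sym (X : category) (a b : X) (i : a ≅ b) : b ≅ a :=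
  Iso (fwd_bwd i) (bwd_fwd i).

Lemma iso_trans_subproof (X : category) (a b c : X) (j : b ≅ c) (i : a ≅ b) :
  (bwd i ∘ bwd j) ∘ (j ∘ i) = idm a /\ (j ∘ i) ∘ (bwd i ∘ bwd j) = idm c.
Proof.
split.
- by rewrite compA -(compA (bwd i)) bwd_fwd compm1 bwd_fwd.
- by rewrite compA -(compA (fwd j)) fwd_bwd compm1 fwd_bwd.
Qed.

Definition iso_trans (X : category) (a b c : X) (j : b ≅ c) (i : a ≅ b) : a ≅ c :=
  Iso (proj1 (iso_trans_subproof j i)) (proj2 (iso_trans_subproof j i)).

Definition functor_id (X : category) : functor X X :=
  @Functor X X (fun a => a) (fun a b f => f) (fun a => erefl) (fun a b c g f => erefl).

Lemma functor_comp_id (X Y Z : category) (G : functor Y Z) (F : functor X Y) (a : X) :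
  fmap G (fmap F (idm a)) = idm (G (F a)).
Proof. by rewrite !fmap_id. Qed.

Lemma functor_comp_comp (X Y Z : category) (G : functor Y Z) (F : functor X Y)
    (a b c : X) (g : b ~> c) (f : a ~> b) :
  fmap G (fmap F (g ∘ f)) = fmap G (fmap F g) ∘ fmap G (fmap F f).
Proof. by rewrite !fmap_comp. Qed.

Definition functor_comp (X Y Z : category) (G : functor Y Z) (F : functor X Y) :
    functor X Z :=
  @Functor X Z (fun a => G (F a)) (fun a b f => fmap G (fmap F f))
    (functor_comp_id G F) (@functor_comp_comp X Y Z G F).

Record nat_iso (X Y : category) (F G : functor X Y) := NatIso {
  ncomp :> forall a, F a ≅ G a;
  ncomp_nat : forall a b (f : a ~> b), fmap G f ∘ ncomp a = ncomp b ∘ fmap F f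
}.

Definition is_equivalence (X Y : category) (F : functor X Y) : Prop :=
  exists G : functor Y X,
    inhabited (nat_iso (functor_comp G F) (functor_id X)) /\
    inhabited (nat_iso (functor_comp F G) (functor_id Y)).

Record cone (J C : category) (D : functor J C) := Cone {
  vertex :> C;
  leg : forall j, vertex ~> D j;
  leg_nat : forall i j (f : i ~> j), fmap D f ∘ leg i = leg j
}.

Definition is_limit (J C : category) (D : functor J C) (L : cone D) : Prop :=
  forall K : cone D, exists! m : K ~> L, forall j, leg L j ∘ m = leg K j.

Definition finite_category (J : category) : Prop :=
  Finite J /\ forall i j : J, Finite (i ~> j).

Definition has_finite_limits (C : category) : Prop :=
  forall J : category, finite_category J ->
  forall D : functor J C, exists L : cone D, is_limit L.

(* A pullback cone together with its (necessarily unique) factorizations. *)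
Record pullback (C : category) (a b c : C) (f : a ~> c) (g : b ~> c) := Pullback {
  pb :> C;
  pr1 : pb ~> a;
  pr2 : pb ~> b;
  pb_square : f ∘ pr1 = g ∘ pr2;
  pb_lift : forall x (h : x ~> a) (k : x ~> b), f ∘ h = g ∘ k -> x ~> pb;
  pr1_lift : forall x (h : x ~> a) (k : x ~> b) (e : f ∘ h = g ∘ k),
    pr1 ∘ pb_lift e = h;
  pr2_lift : forall x (h : x ~> a) (k : x ~> b) (e : f ∘ h = g ∘ k),
    pr2 ∘ pb_lift e = k;
  pb_ext : forall x (m m' : x ~> pb),
    pr1 ∘ m = pr1 ∘ m' -> pr2 ∘ m = pr2 ∘ m' -> m = m'
}.

Definition chosen_pullbacks (C : category) : Type :=
  forall (a b c : C) (f : a ~> c) (g : b ~> c), pullback f g.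

(* Toward [finite_limits_pullbacks]: by choice, a category with finite limits has
   chosen pullbacks. *)
Inductive cospan_ob : Set := Cl | Cr | Cm.

Definition cospan_hom (i j : cospan_ob) : Set :=
  match i, j with
  | Cl, Cl | Cr, Cr | Cm, Cm | Cl, Cm | Cr, Cm => unit
  | _, _ => Empty_set
  end.

Definition cospan_id (i : cospan_ob) : cospan_hom i i :=
  match i with Cl => tt | Cr => tt | Cm => tt end.

Definition cospan_comp (i j k : cospan_ob) :
  cospan_hom j k -> cospan_hom i j -> cospan_hom i k.
Proof. by case: i; case: j; case: k. Defined.

Definition cospan_cat : category.
Proof.
apply: (@Category cospan_ob cospan_hom cospan_id cospan_comp).
- by case; case; case.
- by case; case; case.
- by case; case; case; case; do 3 case.
Defined.

Lemma cospan_finite : finite_category cospan_cat.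
Proof.
split; first by exists (Cl :: Cr :: Cm :: nil); case => /=; intuition.
by case; case; (exists (tt :: nil); case; left) || (exists nil; case).
Qed.

Definition cospan_diagram (C : category) (a b c : C) (f : a ~> c) (g : b ~> c) :
  functor cospan_cat C.
Proof.
unshelve eapply (@Functor cospan_cat C
  (fun i => match i with Cl => a | Cr => b | Cm => c end)).
- by case; case => //= _; first [exact: f | exact: g | exact: idm].
- by case.
- by case; case; case => //= - [] []; rewrite ?comp1m ?compm1.
Defined.

Definition cospan_cone (C : category) (a b c : C) (f : a ~> c) (g : b ~> c)
    (x : C) (h : x ~> a) (k : x ~> b) (e : f ∘ h = g ∘ k) :
  cone (cospan_diagram f g).
Proof.
apply: (@Cone _ _ (cospan_diagram f g) x
  (fun j => match j with Cl => h | Cr => k | Cm => f ∘ h end)).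
by case; case => //= - []; rewrite ?comp1m.
Defined.

Definition finite_limits_pullbacks (C : category) (hC : has_finite_limits C) :
  chosen_pullbacks C.
Proof.
move=> a b c f g.
have [L hL] :=
  constructive_indefinite_description _ (hC _ cospan_finite (cospan_diagram f g)).
have lf : f ∘ leg L (Cl : cospan_cat) = leg L (Cm : cospan_cat).
  exact: (leg_nat L (tt : (Cl : cospan_cat) ~> (Cm : cospan_cat))).
have lg : g ∘ leg L (Cr : cospan_cat) = leg L (Cm : cospan_cat).
  exact: (leg_nat L (tt : (Cr : cospan_cat) ~> (Cm : cospan_cat))).
have sq : f ∘ leg L (Cl : cospan_cat) = g ∘ leg L (Cr : cospan_cat).
  by rewrite lf lg.
have lift x (h : x ~> a) (k : x ~> b) (e : f ∘ h = g ∘ k) :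
  {m : x ~> L | leg L (Cl : cospan_cat) ∘ m = h /\ leg L (Cr : cospan_cat) ∘ m = k}.
  apply: constructive_indefinite_description.
  have [m [hm _]] := hL (cospan_cone e).
  by exists m; split; [exact: (hm Cl) | exact: (hm Cr)].
apply: (@Pullback C a b c f g L (leg L (Cl : cospan_cat)) (leg L (Cr : cospan_cat)) sq
  (fun x h k e => proj1_sig (lift x h k e))).
- by move=> x h k e; exact: (proj1 (proj2_sig (lift x h k e))).
- by move=> x h k e; exact: (proj2 (proj2_sig (lift x h k e))).
- move=> x m m' e1 e2.
  have e : f ∘ (leg L (Cl : cospan_cat) ∘ m') = g ∘ (leg L (Cr : cospan_cat) ∘ m').
    by rewrite !compA lf lg.
  have [n [_ un]] := hL (cospan_cone e).
  have <- : n = m by apply: un; case => //=; rewrite -lf -compA e1.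
  by apply: un; case => //=; rewrite -lf -compA.
Qed.

Reserved Notation "g ⊙ f" (at level 39, left associativity).
Reserved Notation "β ⋆ α" (at level 39, left associativity).

(* The hom-category [bhom A B] has the 1-cells A -> B as objects and the 2-cells as
   morphisms, [∘] being vertical composition of 2-cells; [⊙] composes 1-cells and
   [⋆] composes 2-cells horizontally, both in applicative order. *)
Record bicategory := Bicategory {
  bob :> Type;
  bhom : bob -> bob -> category;
  bid : forall A, bhom A A;
  bcomp : forall A B C, bhom B C -> bhom A B -> bhom A C
    where "g ⊙ f" := (bcomp g f);
  hcomp : forall A B C (g g' : bhom B C) (f f' : bhom A B),
    (g ~> g') -> (f ~> f') -> (g ⊙ f ~> g' ⊙ f')
    where "β ⋆ α" := (hcomp β α);
  hcomp_id : forall A B C (g : bhom B C) (f : bhom A B), idm g ⋆ idm f = idm (g ⊙ f);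
  hcomp_comp : forall A B C (g g' g'' : bhom B C) (f f' f'' : bhom A B)
    (β' : g' ~> g'') (β : g ~> g') (α' : f' ~> f'') (α : f ~> f'),
    (β' ∘ β) ⋆ (α' ∘ α) = (β' ⋆ α') ∘ (β ⋆ α);
  assoc : forall A B C D (h : bhom C D) (g : bhom B C) (f : bhom A B),
    (h ⊙ g) ⊙ f ≅ h ⊙ (g ⊙ f);
  assoc_nat : forall A B C D (h h' : bhom C D) (g g' : bhom B C) (f f' : bhom A B)
    (γ : h ~> h') (β : g ~> g') (α : f ~> f'),
    assoc h' g' f' ∘ ((γ ⋆ β) ⋆ α) = (γ ⋆ (β ⋆ α)) ∘ assoc h g f;
  lunit : forall A B (f : bhom A B), bid B ⊙ f ≅ f;
  lunit_nat : forall A B (f f' : bhom A B) (α : f ~> f'),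
    lunit f' ∘ (idm (bid B) ⋆ α) = α ∘ lunit f;
  runit : forall A B (f : bhom A B), f ⊙ bid A ≅ f;
  runit_nat : forall A B (f f' : bhom A B) (α : f ~> f'),
    runit f' ∘ (α ⋆ idm (bid A)) = α ∘ runit f;
  triangle : forall A B C (g : bhom B C) (f : bhom A B),
    (idm g ⋆ lunit f) ∘ assoc g (bid B) f = runit g ⋆ idm f;
  pentagon : forall A B C D E (k : bhom D E) (h : bhom C D) (g : bhom B C) (f : bhom A B),
    assoc k h (g ⊙ f) ∘ assoc (k ⊙ h) g f
    = (idm k ⋆ assoc h g f) ∘ assoc k (h ⊙ g) f ∘ (assoc k h g ⋆ idm f)
}.

Arguments bhom {b} _ _ : rename.
Arguments bid {b} A : rename.
Arguments bcomp {b A B C} _ _ : rename.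
Arguments hcomp {b A B C g g' f f'} _ _ : rename.
Arguments assoc {b A B C D} _ _ _ : rename.
Arguments lunit {b A B} _ : rename.
Arguments runit {b A B} _ : rename.

Notation "g ⊙ f" := (bcomp g f) : cat_scope.
Notation "β ⋆ α" := (hcomp β α) : cat_scope.

Definition is_bequivalence (M : bicategory) (A B : M) (f : bhom A B) : Prop :=
  exists g : bhom B A,
    inhabited (g ⊙ f ≅ bid A) /\ inhabited (f ⊙ g ≅ bid B).

Lemma postcomp_id (M : bicategory) (K A B : M) (n : bhom A B) (u : bhom K A) :
  idm n ⋆ idm u = idm (n ⊙ u).
Proof. exact: hcomp_id. Qed.

Lemma postcomp_comp (M : bicategory) (K A B : M) (n : bhom A B) (u v w : bhom K A)
    (τ : v ~> w) (σ : u ~> v) :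
  idm n ⋆ (τ ∘ σ) = (idm n ⋆ τ) ∘ (idm n ⋆ σ).
Proof. by rewrite -hcomp_comp comp1m. Qed.

(* The functor M(K,n). *)
Definition postcomp (M : bicategory) (K A B : M) (n : bhom A B) :
    functor (bhom K A) (bhom K B) :=
  @Functor (bhom K A) (bhom K B) (fun u => n ⊙ u) (fun u v σ => idm n ⋆ σ)
    (postcomp_id n) (@postcomp_comp M K A B n).

Section PseudoComma.

Variables (X Y Z : category) (F : functor X Z) (G : functor Y Z).

Record pcomma_ob := PcommaOb {
  pc1 : X;
  pc2 : Y;
  pciso : F pc1 ≅ G pc2
}.

Record pcomma_hom (o o' : pcomma_ob) := PcommaHom {
  pch1 : pc1 o ~> pc1 o';
  pch2 : pc2 o ~> pc2 o';
  pch_comm : fmap G pch2 ∘ pciso o = pciso o' ∘ fmap F pch1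
}.

Lemma pcomma_hom_ext (o o' : pcomma_ob) (f g : pcomma_hom o o') :
  pch1 f = pch1 g -> pch2 f = pch2 g -> f = g.
Proof.
case: f => s t c; case: g => s' t' c' /= e1 e2; subst s' t'.
by rewrite (proof_irrelevance _ c c').
Qed.

Definition pcomma_id (o : pcomma_ob) : pcomma_hom o o.
Proof.
by apply: (@PcommaHom o o (idm _) (idm _)); rewrite !fmap_id comp1m compm1.
Defined.

Definition pcomma_comp (o o' o'' : pcomma_ob)
  (g : pcomma_hom o' o'') (f : pcomma_hom o o') : pcomma_hom o o''.
Proof.
apply: (@PcommaHom o o'' (pch1 g ∘ pch1 f) (pch2 g ∘ pch2 f)).
by rewrite !fmap_comp -compA pch_comm compA pch_comm compA.
Defined.

Definition pcomma : category.
Proof.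
apply: (@Category pcomma_ob pcomma_hom pcomma_id pcomma_comp).
- by move=> a b f; apply: pcomma_hom_ext; rewrite /= comp1m.
- by move=> a b f; apply: pcomma_hom_ext; rewrite /= compm1.
- by move=> a b c d h g f; apply: pcomma_hom_ext; rewrite /= compA.
Defined.

End PseudoComma.

Section Bipullback.

Variables (M : bicategory) (P A B C : M).
Variables (d : bhom P A) (c : bhom P B) (n : bhom A C) (p : bhom B C).
Variable θ : n ⊙ d ≅ p ⊙ c.

Lemma whisker_iso_subproof (K : M) (u : bhom K P) :
  (bwd θ ⋆ idm u) ∘ (θ ⋆ idm u) = idm _ /\ (θ ⋆ idm u) ∘ (bwd θ ⋆ idm u) = idm _.
Proof. by rewrite -!hcomp_comp bwd_fwd fwd_bwd comp1m !hcomp_id. Qed.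

Definition whisker_iso (K : M) (u : bhom K P) : (n ⊙ d) ⊙ u ≅ (p ⊙ c) ⊙ u :=
  Iso (proj1 (whisker_iso_subproof u)) (proj2 (whisker_iso_subproof u)).

(* u |-> (du, θu, cu), where θu is seen as n(du) ≅ p(cu) through the associativity
   constraints. *)
Definition comparison_ob (K : M) (u : bhom K P) :
    pcomma (postcomp K n) (postcomp K p) :=
  @PcommaOb _ _ _ (postcomp K n) (postcomp K p) (d ⊙ u) (c ⊙ u)
    (iso_trans (assoc p c u) (iso_trans (whisker_iso u) (iso_sym (assoc n d u)))).

Lemma assoc_bwd_nat (K : M) (u v : bhom K P) (σ : u ~> v) :
  bwd (assoc n d v) ∘ (idm n ⋆ (idm d ⋆ σ)) = (idm (n ⊙ d) ⋆ σ) ∘ bwd (assoc n d u).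
Proof.
rewrite -[LHS]compm1 -(fwd_bwd (assoc n d u)).
rewrite -(compA (bwd _)) (compA (idm n ⋆ _)) -assoc_nat.
by rewrite -(compA (fwd _)) compA bwd_fwd comp1m hcomp_id.
Qed.

Definition comparison_hom (K : M) (u v : bhom K P) (σ : u ~> v) :
  comparison_ob u ~> comparison_ob v.
Proof.
apply: (@PcommaHom _ _ _ (postcomp K n) (postcomp K p)
  (comparison_ob u) (comparison_ob v) (idm d ⋆ σ) (idm c ⋆ σ)).
rewrite /= compA -assoc_nat hcomp_id -!compA assoc_bwd_nat.
congr (_ ∘ _); rewrite !compA; congr (_ ∘ _).
by rewrite -!hcomp_comp !comp1m !compm1.
Defined.

Definition comparison (K : M) :
  functor (bhom K P) (pcomma (postcomp K n) (postcomp K p)).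
Proof.
apply: (@Functor _ _ (@comparison_ob K) (@comparison_hom K)).
- by move=> u; apply: pcomma_hom_ext; rewrite /= hcomp_id.
- by move=> u v w τ σ; apply: pcomma_hom_ext; rewrite /= -hcomp_comp comp1m.
Defined.

Definition is_bipullback : Prop := forall K : M, is_equivalence (comparison K).

End Bipullback.

Definition is_set_pullback (P A B C : Type)
    (a : P -> A) (b : P -> B) (f : A -> C) (g : B -> C) : Prop :=
  (forall z, f (a z) = g (b z)) /\
  (forall x y, f x = g y -> exists! z, a z = x /\ b z = y).

Definition is_cartesian (E B : category) (p : functor E B) (e' e : E) (χ : e' ~> e) : Prop :=
  forall k : E,
    is_set_pullback
      (fun h : k ~> e' => χ ∘ h) (fun h : k ~> e' => fmap p h)
      (fun h : k ~> e => fmap p h) (fun h : p k ~> p e' => fmap p χ ∘ h).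

Definition is_groupoid_fibration (E B : category) (p : functor E B) : Prop :=
  (forall (e : E) (b : B) (β : b ~> p e),
     exists (e' : E) (χ : e' ~> e) (i : b ≅ p e'), fmap p χ ∘ i = β) /\
  (forall (e' e : E) (χ : e' ~> e), is_cartesian p χ).

Definition is_bgroupoid_fibration (M : bicategory) (E B : M) (p : bhom E B) : Prop :=
  forall K : M, is_groupoid_fibration (postcomp K p).

Definition is_right_lifting (M : bicategory) (K Y Z : M) (n : bhom Y Z) (u : bhom K Z)
    (r : bhom K Y) (ϖ : n ⊙ r ~> u) : Prop :=
  forall (v : bhom K Y) (τ : n ⊙ v ~> u), exists! σ : v ~> r, ϖ ∘ (idm n ⋆ σ) = τ.

Definition is_right_lifter (M : bicategory) (Y Z : M) (n : bhom Y Z) : Prop :=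
  forall (K : M) (u : bhom K Z),
    exists (r : bhom K Y) (ϖ : n ⊙ r ~> u), is_right_lifting ϖ.

Definition cell_class (M : bicategory) : Type := forall A B : M, bhom A B -> Prop.

Record is_calibration (M : bicategory) (neat : cell_class M) : Prop := {
  neat_equivalence : forall (A B : M) (f : bhom A B), is_bequivalence f -> neat A B f;
  neat_iso : forall (A B : M) (f g : bhom A B), f ≅ g -> neat A B f -> neat A B g;
  neat_comp : forall (A B C : M) (p : bhom B C) (q : bhom A B),
    neat B C p -> (neat A C (p ⊙ q) <-> neat A B q);
  neat_fibration : forall (A B : M) (p : bhom A B), neat A B p -> is_bgroupoid_fibration p;
  neat_bipullback : forall (S Y T : M) (p : bhom S Y) (n : bhom T Y),
    is_right_lifter n -> neat S Y p ->
    exists (P : M) (n' : bhom P S) (p' : bhom P T) (θ : n ⊙ p' ≅ p ⊙ n'),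
      is_bipullback θ /\ neat P T p'
}.

Definition polynomic (M : bicategory) : Prop :=
  is_calibration (@is_bgroupoid_fibration M).

Record span (C : category) (X Y : C) := Span {
  apex : C;
  lleg : apex ~> X;
  rleg : apex ~> Y
}.

Record span_map (C : category) (X Y : C) (s t : span X Y) := SpanMap {
  smap :> apex s ~> apex t;
  smap_l : lleg t ∘ smap = lleg s;
  smap_r : rleg t ∘ smap = rleg s
}.

Lemma span_map_ext (C : category) (X Y : C) (s t : span X Y) (f g : span_map s t) :
  smap f = smap g -> f = g.
Proof.
case: f => f l r; case: g => g l' r' /= e; subst g.
by rewrite (proof_irrelevance _ l l') (proof_irrelevance _ r r').
Qed.

Definition span_map_id (C : category) (X Y : C) (s : span X Y) : span_map s s :=
  SpanMap (compm1 (lleg s)) (compm1 (rleg s)).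

Definition span_map_comp (C : category) (X Y : C) (s t w : span X Y)
  (g : span_map t w) (f : span_map s t) : span_map s w.
Proof.
by apply: (@SpanMap _ _ _ s w (g ∘ f)); rewrite compA ?smap_l ?smap_r.
Defined.

Definition span_cat (C : category) (X Y : C) : category.
Proof.
apply: (@Category (span X Y) (@span_map C X Y) (@span_map_id C X Y)
  (@span_map_comp C X Y)).
- by move=> s t f; apply: span_map_ext; rewrite /= comp1m.
- by move=> s t f; apply: span_map_ext; rewrite /= compm1.
- by move=> s t w z h g f; apply: span_map_ext; rewrite /= compA.
Defined.

Lemma lleg_smapA (C : category) (X Y : C) (s t : span X Y) (f : span_map s t)
    (x : C) (h : x ~> apex s) :
  lleg t ∘ (f ∘ h) = lleg s ∘ h.
Proof. by rewrite compA smap_l. Qed.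

Lemma rleg_smapA (C : category) (X Y : C) (s t : span X Y) (f : span_map s t)
    (x : C) (h : x ~> apex s) :
  rleg t ∘ (f ∘ h) = rleg s ∘ h.
Proof. by rewrite compA smap_r. Qed.

Lemma pr1_liftA (C : category) (a b c : C) (f : a ~> c) (g : b ~> c) (P : pullback f g)
    (x y : C) (h : x ~> a) (k : x ~> b) (e : f ∘ h = g ∘ k) (m : y ~> x) :
  pr1 P ∘ (pb_lift P e ∘ m) = h ∘ m.
Proof. by rewrite compA pr1_lift. Qed.

Lemma pr2_liftA (C : category) (a b c : C) (f : a ~> c) (g : b ~> c) (P : pullback f g)
    (x y : C) (h : x ~> a) (k : x ~> b) (e : f ∘ h = g ∘ k) (m : y ~> x) :
  pr2 P ∘ (pb_lift P e ∘ m) = k ∘ m.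
Proof. by rewrite compA pr2_lift. Qed.

Lemma pb_squareA (C : category) (a b c : C) (f : a ~> c) (g : b ~> c) (P : pullback f g)
    (y : C) (m : y ~> P) :
  f ∘ (pr1 P ∘ m) = g ∘ (pr2 P ∘ m).
Proof. by rewrite !compA pb_square. Qed.

Ltac span_simp :=
  rewrite /= -?compA ?(pr1_lift, pr2_lift, pr1_liftA, pr2_liftA, comp1m, compm1,
    smap_l, smap_r, lleg_smapA, rleg_smapA) /=.

Ltac span_eq := repeat progress span_simp.

Section Spn.

Variables (C : category) (PB : chosen_pullbacks C).

Definition span_id (X : C) : span X X := Span (idm X) (idm X).

(* X <- S -> Y followed by Y <- T -> Z, with apex the pullback of S -> Y <- T. *)
Definition span_comp (X Y Z : C) (t : span Y Z) (s : span X Y) : span X Z :=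
  let P := PB (rleg s) (lleg t) in
  @Span C X Z P (lleg s ∘ pr1 P) (rleg t ∘ pr2 P).

Lemma span_hcomp_eq (X Y Z : C) (t t' : span Y Z) (s s' : span X Y)
    (β : span_map t t') (α : span_map s s') :
  rleg s' ∘ (α ∘ pr1 (PB (rleg s) (lleg t))) = lleg t' ∘ (β ∘ pr2 (PB (rleg s) (lleg t))).
Proof. by rewrite lleg_smapA rleg_smapA pb_square. Qed.

Definition span_hcomp (X Y Z : C) (t t' : span Y Z) (s s' : span X Y)
  (β : span_map t t') (α : span_map s s') :
  span_map (span_comp t s) (span_comp t' s').
Proof.
by apply: (@SpanMap _ _ _ (span_comp t s) (span_comp t' s')
  (pb_lift _ (span_hcomp_eq β α))); span_eq.
Defined.

Section Assoc.

Variables (X Y Z W : C) (w : span Z W) (t : span Y Z) (s : span X Y).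

Let P := PB (rleg s) (lleg t).
Let Q := PB (rleg t) (lleg w).
Let L := PB (rleg s) (lleg (span_comp w t)).
Let R := PB (rleg (span_comp t s)) (lleg w).

Lemma span_assoc_eq1 : rleg s ∘ pr1 L = lleg t ∘ (pr1 Q ∘ pr2 L).
Proof. by rewrite pb_square /= -compA. Qed.

Lemma span_assoc_eq2 :
  rleg (span_comp t s) ∘ pb_lift P span_assoc_eq1 = lleg w ∘ (pr2 Q ∘ pr2 L).
Proof. by rewrite /= -compA pr2_lift pb_squareA. Qed.

Lemma span_assoc_eq3 : rleg t ∘ (pr2 P ∘ pr1 R) = lleg w ∘ pr2 R.
Proof. by rewrite -pb_square /= -compA. Qed.

Lemma span_assoc_eq4 :
  rleg s ∘ (pr1 P ∘ pr1 R) = lleg (span_comp w t) ∘ pb_lift Q span_assoc_eq3.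
Proof. by rewrite /= -compA pr1_lift pb_squareA. Qed.

Definition span_assoc_fwd :
  span_map (span_comp (span_comp w t) s) (span_comp w (span_comp t s)).
Proof.
by apply: (@SpanMap _ _ _ (span_comp (span_comp w t) s) (span_comp w (span_comp t s))
  (pb_lift R span_assoc_eq2)); span_eq.
Defined.

Definition span_assoc_bwd :
  span_map (span_comp w (span_comp t s)) (span_comp (span_comp w t) s).
Proof.
by apply: (@SpanMap _ _ _ (span_comp w (span_comp t s)) (span_comp (span_comp w t) s)
  (pb_lift L span_assoc_eq4)); span_eq.
Defined.

End Assoc.

Ltac span_ext := apply: span_map_ext; repeat (apply: pb_ext); span_eq.

Definition span_assoc (X Y Z W : C) (w : span Z W) (t : span Y Z) (s : span X Y) :
  @iso (span_cat X W) (span_comp (span_comp w t) s) (span_comp w (span_comp t s)).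
Proof.
apply: (@Iso (span_cat X W) _ _ (span_assoc_fwd w t s) (span_assoc_bwd w t s));
  by span_ext.
Defined.

Definition span_lunit_fwd (X Y : C) (s : span X Y) :
  span_map (span_comp (span_id Y) s) s.
Proof.
apply: (@SpanMap _ _ _ (span_comp (span_id Y) s) s (pr1 _)) => //=.
by rewrite pb_square.
Defined.

Lemma span_lunit_eq (X Y : C) (s : span X Y) :
  rleg s ∘ idm (apex s) = lleg (span_id Y) ∘ rleg s.
Proof. by rewrite compm1 comp1m. Qed.

Definition span_lunit_bwd (X Y : C) (s : span X Y) :
  span_map s (span_comp (span_id Y) s).
Proof.
by apply: (@SpanMap _ _ _ s (span_comp (span_id Y) s)
  (pb_lift _ (span_lunit_eq s))); span_eq.
Defined.

Definition span_lunit (X Y : C) (s : span X Y) :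
  @iso (span_cat X Y) (span_comp (span_id Y) s) s.
Proof.
apply: (@Iso (span_cat X Y) _ _ (span_lunit_fwd s) (span_lunit_bwd s)).
- by span_ext; rewrite ?pb_square /= ?comp1m.
- by apply: span_map_ext; span_eq.
Defined.

Definition span_runit_fwd (X Y : C) (s : span X Y) :
  span_map (span_comp s (span_id X)) s.
Proof.
apply: (@SpanMap _ _ _ (span_comp s (span_id X)) s (pr2 _)) => //=.
by rewrite -pb_square.
Defined.

Lemma span_runit_eq (X Y : C) (s : span X Y) :
  rleg (span_id X) ∘ lleg s = lleg s ∘ idm (apex s).
Proof. by rewrite compm1 comp1m. Qed.

Definition span_runit_bwd (X Y : C) (s : span X Y) :
  span_map s (span_comp s (span_id X)).
Proof.
by apply: (@SpanMap _ _ _ s (span_comp s (span_id X))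
  (pb_lift _ (span_runit_eq s))); span_eq.
Defined.

Definition span_runit (X Y : C) (s : span X Y) :
  @iso (span_cat X Y) (span_comp s (span_id X)) s.
Proof.
apply: (@Iso (span_cat X Y) _ _ (span_runit_fwd s) (span_runit_bwd s)).
- by span_ext; rewrite -?pb_square /= ?comp1m.
- by apply: span_map_ext; span_eq.
Defined.

Lemma span_hcomp_id (X Y Z : C) (t : span Y Z) (s : span X Y) :
  span_hcomp (span_map_id t) (span_map_id s) = span_map_id (span_comp t s).
Proof. by span_ext. Qed.

Lemma span_hcomp_comp (X Y Z : C) (t t' t'' : span Y Z) (s s' s'' : span X Y)
    (β' : span_map t' t'') (β : span_map t t') (α' : span_map s' s'') (α : span_map s s') :
  span_hcomp (span_map_comp β' β) (span_map_comp α' α)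
  = span_map_comp (span_hcomp β' α') (span_hcomp β α).
Proof. by span_ext. Qed.

Lemma span_assoc_nat (X Y Z W : C) (w w' : span Z W) (t t' : span Y Z) (s s' : span X Y)
    (γ : span_map w w') (β : span_map t t') (α : span_map s s') :
  span_map_comp (span_assoc_fwd w' t' s') (span_hcomp (span_hcomp γ β) α)
  = span_map_comp (span_hcomp γ (span_hcomp β α)) (span_assoc_fwd w t s).
Proof. by span_ext. Qed.

Lemma span_lunit_nat (X Y : C) (s s' : span X Y) (α : span_map s s') :
  span_map_comp (span_lunit_fwd s') (span_hcomp (span_map_id (span_id Y)) α)
  = span_map_comp α (span_lunit_fwd s).
Proof. by apply: span_map_ext; span_eq. Qed.

Lemma span_runit_nat (X Y : C) (s s' : span X Y) (α : span_map s s') :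
  span_map_comp (span_runit_fwd s') (span_hcomp α (span_map_id (span_id X)))
  = span_map_comp α (span_runit_fwd s).
Proof. by apply: span_map_ext; span_eq. Qed.

Lemma span_triangle (X Y Z : C) (t : span Y Z) (s : span X Y) :
  span_map_comp (span_hcomp (span_map_id t) (span_lunit_fwd s))
    (span_assoc_fwd t (span_id Y) s)
  = span_hcomp (span_runit_fwd t) (span_map_id s).
Proof.
span_ext; rewrite /= -?compA ?(pr1_liftA, pr2_liftA, pr1_lift, pr2_lift).
- by rewrite -compA !pr1_lift [RHS]comp1m.
- by rewrite -compA pr2_lift [LHS]comp1m.
Qed.

Lemma span_pentagon (X Y Z W V : C)
    (k : span W V) (h : span Z W) (g : span Y Z) (f : span X Y) :
  span_map_comp (span_assoc_fwd k h (span_comp g f)) (span_assoc_fwd (span_comp k h) g f)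
  = span_map_comp
      (span_map_comp (span_hcomp (span_map_id k) (span_assoc_fwd h g f))
        (span_assoc_fwd k (span_comp h g) f))
      (span_hcomp (span_assoc_fwd k h g) (span_map_id f)).
Proof. by span_ext. Qed.

Definition Spn : bicategory :=
  @Bicategory C (@span_cat C) span_id span_comp span_hcomp span_hcomp_id span_hcomp_comp
    span_assoc span_assoc_nat span_lunit span_lunit_nat span_runit span_runit_nat
    span_triangle span_pentagon.

End Spn.

(* Main.v *)
(** A span [X <-u- S -p-> Y] is a groupoid fibration in [Spn C] exactly when [u] is
    invertible; this gives every condition of a calibration except the existence of
    bipullbacks. For that one, let [p = (S <-i- S0 -p0-> Y)] with [i] invertible and let
    [n = (T <-u- E -q-> Y)] be a right lifter. The right lifting through [n] of the span
    [1 <- S0 -p0-> Y] is an object [r : P -> T] over [T] together with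
    [ϖ : P ×_T E -> S0], and maps into [P] over [T] correspond to maps into [S0] over [Y]
    out of the pullback along [u]. This universal property makes the spans
    [P <-1- P -r-> T] and [P <- P ×_T E -iϖ-> S] the projections of a bipullback of
    [n] and [p]. *)

From Stdlib Require Import ssreflect ssrfun.
From Stdlib Require Import IndefiniteDescription.
Require Import Defs.

Set Implicit Arguments.
Unset Strict Implicit.
Unset Printing Implicit Defensive.

Local Open Scope cat_scope.

(** * Terminal objects from finite limits *)

Definition empty_cat : category.
Proof.
apply: (@Category Empty_set (fun _ _ => Empty_set) (fun a => a)
  (fun a _ _ _ _ => a)); by case.
Defined.

Definition empty_diagram (C : category) : functor empty_cat C.
Proof.
apply: (@Functor empty_cat C (fun e : Empty_set => match e with end)
  (fun (a : Empty_set) _ _ => match a with end)); by case.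
Defined.

Definition empty_cone (C : category) (x : C) : cone (empty_diagram C).
Proof. by apply: (@Cone _ _ (empty_diagram C) x
  (fun e : Empty_set => match e with end)); case. Defined.

(** A cone over the empty diagram is a bare object, so a limit of that diagram is terminal. *)
Lemma has_finite_limits_terminal (C : category) :
  has_finite_limits C ->
  exists T : C, inhabited (forall x : C, x ~> T) /\
    forall (x : C) (f g : x ~> T), f = g.
Proof.
move=> hC.
have fin : finite_category empty_cat by split; [exists nil; case | case].
have [L hL] := hC _ fin (empty_diagram C).
exists L; split.
  constructor=> x.
  have [m _] := constructive_indefinite_description _ (hL (empty_cone x)).
  exact: m.
move=> x f g; have [m [_ um]] := hL (empty_cone x).
have <- : m = f by apply: um; case.
by apply: um; case.
Qed.

(** * A criterion for equivalences of categories *)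

Section FullyFaithful.

Variables (X Y : category) (F : functor X Y).

Hypothesis faithfulF : forall (a b : X) (f g : a ~> b), fmap F f = fmap F g -> f = g.
Hypothesis fullF : forall (a b : X) (h : F a ~> F b), exists f, fmap F f = h.
Hypothesis essurjF : forall y : Y, exists x : X, inhabited (F x ≅ y).

(** Choice picks preimages of objects and arrows; faithfulness makes the choice functorial and the
    isomorphisms natural. *)
Lemma fully_faithful_essurj_equivalence : is_equivalence F.
Proof.
have inv y : {x : X & F x ≅ y}.
  have [x hx] := constructive_indefinite_description _ (essurjF y).
  have [i _] := constructive_indefinite_description (fun _ : F x ≅ y => True)
    (match hx with inhabits i => ex_intro _ i I end).
  by exists x.
pose g y := projT1 (inv y); pose e y : F (g y) ≅ y := projT2 (inv y).
pose lift a b (h : F a ~> F b) :=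
  proj1_sig (constructive_indefinite_description _ (fullF h)).
have liftE a b (h : F a ~> F b) : fmap F (lift a b h) = h.
  exact: (proj2_sig (constructive_indefinite_description _ (fullF h))).
pose gmap a b (f : a ~> b) := lift (g a) (g b) (bwd (e b) ∘ f ∘ e a).
have gid a : gmap a a (idm a) = idm (g a).
  by apply: faithfulF; rewrite liftE compm1 bwd_fwd fmap_id.
have gcomp a b c (k : b ~> c) (f : a ~> b) : gmap a c (k ∘ f) = gmap b c k ∘ gmap a b f.
  apply: faithfulF; rewrite fmap_comp !liftE -!compA (compA (e b)).
  by rewrite fwd_bwd comp1m.
exists (Functor gid gcomp); split; constructor.
  have inv1 x : lift _ _ (bwd (e (F x))) ∘ lift _ _ (fwd (e (F x))) = idm (g (F x)).
    by apply: faithfulF; rewrite fmap_comp !liftE bwd_fwd fmap_id.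
  have inv2 x : lift _ _ (fwd (e (F x))) ∘ lift _ _ (bwd (e (F x))) = idm x.
    by apply: faithfulF; rewrite fmap_comp !liftE fwd_bwd fmap_id.
  apply: (@NatIso _ _ (functor_comp (Functor gid gcomp) F) (functor_id X)
    (fun x => Iso (inv1 x) (inv2 x))) => a b f /=.
  apply: faithfulF; rewrite !fmap_comp !liftE !compA.
  by rewrite fwd_bwd comp1m.
apply: (@NatIso _ _ (functor_comp F (Functor gid gcomp)) (functor_id Y) e) => a b f /=.
by rewrite liftE !compA fwd_bwd comp1m.
Qed.

End FullyFaithful.

(** * Isomorphisms in categories and in pseudo-comma categories *)

Lemma iso_epi (X : category) (a b c : X) (i : a ≅ b) (f g : b ~> c) :
  f ∘ i = g ∘ i -> f = g.
Proof.
by move/(f_equal (fun m => m ∘ bwd i)); rewrite -!compA fwd_bwd !compm1.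
Qed.

Definition functor_iso (X Y : category) (F : functor X Y) (a b : X) (i : a ≅ b) : F a ≅ F b.
Proof.
by apply: (@Iso _ _ _ (fmap F i) (fmap F (bwd i)));
  rewrite -fmap_comp ?bwd_fwd ?fwd_bwd fmap_id.
Defined.

Definition invertible (C : category) (a b : C) (f : a ~> b) : Prop :=
  exists g : b ~> a, g ∘ f = idm a /\ f ∘ g = idm b.

Section Invertible.

Variable C : category.

Lemma invertible_idm (a : C) : invertible (idm a).
Proof. by exists (idm a); rewrite comp1m. Qed.

Lemma invertible_comp (a b c : C) (g : b ~> c) (f : a ~> b) :
  invertible g -> invertible f -> invertible (g ∘ f).
Proof.
move=> [g' [g1 g2]] [f' [f1 f2]]; exists (f' ∘ g'); split.
  by rewrite -compA (compA g') g1 comp1m.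
by rewrite -compA (compA f) f2 comp1m.
Qed.

Lemma invertible_compr (a b c : C) (g : b ~> c) (f : a ~> b) :
  invertible f -> invertible (g ∘ f) -> invertible g.
Proof.
move=> [f' [f1 f2]] gf.
have -> : g = (g ∘ f) ∘ f' by rewrite -compA f2 compm1.
by apply: invertible_comp => //; exists f.
Qed.

Lemma invertible_epi (a b c : C) (e : a ~> b) (f g : b ~> c) :
  invertible e -> f ∘ e = g ∘ e -> f = g.
Proof.
by move=> [e' [_ ee']] /(f_equal (fun m => m ∘ e')); rewrite -!compA ee' !compm1.
Qed.

Lemma invertible_pr1 (a b c : C) (f : a ~> c) (g : b ~> c) (P : pullback f g) :
  invertible g -> invertible (pr1 P).
Proof.
move=> [g' [g1 g2]].
have e : f ∘ idm a = g ∘ (g' ∘ f) by rewrite compA g2 compm1 comp1m.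
exists (pb_lift P e); split; last exact: pr1_lift.
apply: pb_ext; rewrite ?pr1_liftA ?pr2_liftA ?comp1m compm1 //.
by rewrite -compA pb_square compA g1 comp1m.
Qed.

Lemma invertible_split_epi_mono (a b : C) (f : a ~> b) (s : b ~> a) :
  f ∘ s = idm b -> (forall x (h k : x ~> a), f ∘ h = f ∘ k -> h = k) -> invertible f.
Proof.
move=> fs mono; exists s; split=> //.
by apply: mono; rewrite compA fs comp1m compm1.
Qed.

End Invertible.

(** The inverses of [i] and [j] automatically satisfy the compatibility condition in the other
    direction. *)
Lemma pcomma_iso (X Y Z : category) (F : functor X Z) (G : functor Y Z)
    (o o' : pcomma F G) (i : pc1 o ≅ pc1 o') (j : pc2 o ≅ pc2 o') :
  fmap G j ∘ pciso o = pciso o' ∘ fmap F i -> inhabited (o ≅ o').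
Proof.
move=> e.
have e' : fmap G (bwd j) ∘ pciso o' = pciso o ∘ fmap F (bwd i).
  rewrite -[LHS]compm1 -fmap_id -(fwd_bwd i) fmap_comp !compA -(compA _ (pciso o')) -e.
  by rewrite !compA -fmap_comp bwd_fwd fmap_id comp1m.
pose f : pcomma_hom o o' := PcommaHom e.
pose g : pcomma_hom o' o := PcommaHom e'.
have gf : pcomma_comp g f = pcomma_id o by apply: pcomma_hom_ext; exact: bwd_fwd.
have fg : pcomma_comp f g = pcomma_id o' by apply: pcomma_hom_ext; exact: fwd_bwd.
by constructor; exact: (@Iso (pcomma F G) o o' f g gf fg).
Qed.

(** * Left legs of equivalences and of groupoid fibrations of spans *)

Section Spans.

Variables (C : category) (PB : chosen_pullbacks C).

Lemma span_map_iso (X Y : C) (s t : span X Y) (f : span_map s t) :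
  invertible (smap f) -> exists i : @iso (span_cat X Y) s t, fwd i = f.
Proof.
move=> [g [gf fg]].
have gl : lleg s ∘ g = lleg t by rewrite -(smap_l f) -compA fg compm1.
have gr : rleg s ∘ g = rleg t by rewrite -(smap_r f) -compA fg compm1.
pose g' : span_map t s := SpanMap gl gr.
have gf' : span_map_comp g' f = span_map_id s by apply: span_map_ext.
have fg' : span_map_comp f g' = span_map_id t by apply: span_map_ext.
by exists (@Iso (span_cat X Y) s t f g' gf' fg').
Qed.

Lemma span_iso_lleg (X Y : C) (s t : span X Y) :
  @iso (span_cat X Y) s t -> invertible (lleg s) -> invertible (lleg t).
Proof.
move=> i; rewrite -(smap_l (fwd i)); apply: invertible_compr.
exists (smap (bwd i)); split.
  exact: (f_equal (@smap _ _ _ _ _) (bwd_fwd i)).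
exact: (f_equal (@smap _ _ _ _ _) (fwd_bwd i)).
Qed.

(* If [gf ≅ 1] then [lleg f] and [rleg g] are split epimorphisms. If moreover [fg ≅ 1],
   the projection to [apex g] of the pullback of [rleg g] and [lleg f] is monic, and it is
   the pullback of [lleg f] along the split epimorphism [rleg g]; so [lleg f] is monic. *)
Lemma equivalence_lleg_invertible (X Y : C) (f : span X Y) :
  is_bequivalence (f : bhom (X : Spn PB) (Y : Spn PB)) -> invertible (lleg f).
Proof.
move=> [g [[i] [j]]].
have [r [_ hr]] := span_iso_lleg (iso_sym i) (invertible_idm X).
have [l [hl _]] := span_iso_lleg (iso_sym j) (invertible_idm Y).
have [s hs] : exists s, rleg g ∘ s = idm X.
  exists (pr2 (PB (rleg f) (lleg g)) ∘ bwd i).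
  by have := smap_r (bwd i); rewrite /= compA.
apply: (@invertible_split_epi_mono _ _ _ _ (pr1 (PB (rleg f) (lleg g)) ∘ r)).
  by rewrite compA.
move=> x h k e.
have eh : rleg g ∘ (s ∘ (lleg f ∘ h)) = lleg f ∘ h by rewrite compA hs comp1m.
have ek : rleg g ∘ (s ∘ (lleg f ∘ h)) = lleg f ∘ k by rewrite compA hs comp1m.
rewrite -(pr2_lift (PB (rleg g) (lleg f)) eh) -(pr2_lift (PB (rleg g) (lleg f)) ek).
congr (_ ∘ _).
have hl' : l ∘ (lleg g ∘ pr1 (PB (rleg g) (lleg f))) = idm (PB (rleg g) (lleg f)) by [].
rewrite -[LHS]comp1m -[RHS]comp1m -hl'.
by rewrite -!compA !pr1_lift.
Qed.

(* Apply cartesianness of the 2-cell [(S,u,u) -> (X,1,1)] given by [u] to the identity of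
   [(X,1,1)] and the diagonal of [S]. *)
Lemma fibration_lleg_invertible (X Y : C) (p : span X Y) :
  is_bgroupoid_fibration (p : bhom (X : Spn PB) (Y : Spn PB)) -> invertible (lleg p).
Proof.
move=> hp; have [_ cart] := hp X.
pose e : span X X := Span (idm X) (idm X).
pose e' : span X X := Span (lleg p) (lleg p).
have e1 : lleg e ∘ lleg p = lleg e' by rewrite comp1m.
pose χ : span_map e' e := @SpanMap _ _ _ e' e (lleg p) e1 e1.
have dg : rleg e' ∘ pr2 (PB (rleg e) (lleg p)) = lleg p ∘ pr2 (PB (rleg e) (lleg p)) by [].
have sq := pb_square (PB (rleg e) (lleg p)).
have dl : lleg (span_comp PB p e') ∘ pb_lift _ dg = lleg (span_comp PB p e).
  by rewrite /= -compA pr1_lift -sq.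
have dr : rleg (span_comp PB p e') ∘ pb_lift _ dg = rleg (span_comp PB p e).
  by rewrite /= -compA pr2_lift.
pose d := @SpanMap _ _ _ (span_comp PB p e) (span_comp PB p e') _ dl dr.
have [_ lift] := cart e' e χ e.
have exd : span_hcomp PB (span_map_id p) (span_map_id e)
  = span_map_comp (span_hcomp PB (span_map_id p) χ) d.
  apply: span_map_ext; apply: pb_ext;
    rewrite /= ?(pr1_lift, pr2_lift, pr1_liftA, pr2_liftA) -compA.
    by rewrite pr1_lift -sq.
  by rewrite pr2_lift.
have [h [[h1 h2] _]] := lift (span_map_id e) d exd.
have {}h1 := f_equal (@smap _ _ _ _ _) h1.
have {}h2 := f_equal (fun m : span_map (span_comp PB p e) (span_comp PB p e') =>
  pr1 (PB (rleg e') (lleg p)) ∘ smap m) h2.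
rewrite /= in h1.
move: h2; rewrite /= !pr1_lift => h2.
exists h; split=> //.
(* Evaluated at the element [(lleg p, idm)] of the pullback, [h2] becomes [h ∘ lleg p = idm]. *)
have e2 : rleg e ∘ lleg p = lleg p ∘ idm _ by rewrite compm1 comp1m.
have := f_equal (fun m => m ∘ pb_lift _ e2) h2.
by rewrite -compA pr1_lift pr2_lift.
Qed.

(** * Postcomposition with a span whose left leg is invertible *)

Section Postcomposition.

Variables (K X Y : C) (p : span X Y).
Hypothesis hp : invertible (lleg p).

(** The projection from the apex of [p ⊙ v] to [apex v] is a pullback of [lleg p], hence
    invertible. *)
Lemma postcomp_faithful (v v' : span K X) (f g : span_map v v') :
  span_hcomp PB (span_map_id p) f = span_hcomp PB (span_map_id p) g -> f = g.
Proof.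
move=> e; apply: span_map_ext.
have := f_equal (fun m : span_map (span_comp PB p v) (span_comp PB p v') =>
  pr1 (PB (rleg v') (lleg p)) ∘ smap m) e; rewrite /= !pr1_lift.
have [s [_ hs]] := invertible_pr1 (PB (rleg v) (lleg p)) hp.
by move/(f_equal (fun m => m ∘ s)); rewrite -!compA hs !compm1.
Qed.

(** Conjugating [f] by the invertible first projections gives the candidate. A 2-cell between
    composites preserves only [rleg p ∘ pr2]; preserving [pr2] itself is what makes the candidate
    respect the right legs into [X]. *)
Lemma postcomp_full (v v' : span K X) (f : span_map (span_comp PB p v) (span_comp PB p v')) :
  pr2 (PB (rleg v') (lleg p)) ∘ f = pr2 (PB (rleg v) (lleg p)) ->
  exists t : span_map v v', span_hcomp PB (span_map_id p) t = f.
Proof.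
move=> e.
have [s [hs' hs]] := invertible_pr1 (PB (rleg v) (lleg p)) hp.
have tl : lleg v' ∘ (pr1 (PB (rleg v') (lleg p)) ∘ f ∘ s) = lleg v.
  have := smap_l f; rewrite /= !compA => ->.
  by rewrite -compA hs compm1.
have tr : rleg v' ∘ (pr1 (PB (rleg v') (lleg p)) ∘ f ∘ s) = rleg v.
  by rewrite !compA pb_square -(compA _ _ (smap f)) e -pb_square -compA hs compm1.
exists (SpanMap tl tr); apply: span_map_ext; apply: pb_ext.
  by rewrite /= pr1_lift -!compA hs' compm1.
by rewrite /= pr2_lift comp1m e.
Qed.

Lemma postcomp_full_iso (v v' : span K X)
    (f : @iso (span_cat K Y) (span_comp PB p v) (span_comp PB p v')) :
  pr2 (PB (rleg v') (lleg p)) ∘ smap (fwd f) = pr2 (PB (rleg v) (lleg p)) ->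
  exists t : @iso (span_cat K X) v v', span_hcomp PB (span_map_id p) (fwd t) = fwd f.
Proof.
move=> e.
have e' : pr2 (PB (rleg v) (lleg p)) ∘ smap (bwd f) = pr2 (PB (rleg v') (lleg p)).
  rewrite -e -compA (f_equal (@smap _ _ _ _ _) (fwd_bwd f) : smap (fwd f) ∘ smap (bwd f) = idm _).
  exact: compm1.
have [t ht] := postcomp_full e; have [t' ht'] := postcomp_full e'.
have t't : span_map_comp t' t = span_map_id v.
  apply: postcomp_faithful.
  transitivity (span_map_comp (span_hcomp PB (span_map_id p) t') (span_hcomp PB (span_map_id p) t)).
    exact: (fmap_comp (@postcomp (Spn PB) K X Y p)).
  by rewrite ht ht' span_hcomp_id; exact: (bwd_fwd f).
have tt' : span_map_comp t t' = span_map_id v'.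
  apply: postcomp_faithful.
  transitivity (span_map_comp (span_hcomp PB (span_map_id p) t) (span_hcomp PB (span_map_id p) t')).
    exact: (fmap_comp (@postcomp (Spn PB) K X Y p)).
  by rewrite ht ht' span_hcomp_id; exact: (fwd_bwd f).
by exists (@Iso (span_cat K X) v v' t t' t't tt').
Qed.

End Postcomposition.

(** For (i), [β] determines a map from [apex b] to [apex p], which [lleg p] carries to the new right
    leg into [X]. For (ii), whiskering with [idm p] leaves [pr2] unchanged, so the commuting square
    supplies the side condition of [postcomp_full]. *)
Lemma lleg_invertible_fibration (X Y : C) (p : span X Y) :
  invertible (lleg p) -> is_bgroupoid_fibration (p : bhom (X : Spn PB) (Y : Spn PB)).
Proof.
move=> hp K; split.
  move=> e b β.
  pose e' : span K X := Span (lleg b) (lleg p ∘ (pr2 (PB (rleg e) (lleg p)) ∘ smap β)).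
  have cl : lleg e ∘ (pr1 (PB (rleg e) (lleg p)) ∘ smap β) = lleg e'.
    by rewrite compA; exact: (smap_l β).
  have cr : rleg e ∘ (pr1 (PB (rleg e) (lleg p)) ∘ smap β) = rleg e'.
    by rewrite pb_squareA.
  have li : rleg e' ∘ idm _ = lleg p ∘ (pr2 (PB (rleg e) (lleg p)) ∘ smap β).
    by rewrite compm1.
  pose λ := pb_lift (PB (rleg e') (lleg p)) li.
  have λl : lleg (span_comp PB p e') ∘ λ = lleg b.
    by rewrite /= -compA pr1_lift compm1.
  have λr : rleg (span_comp PB p e') ∘ λ = rleg b.
    by rewrite /= -compA pr2_lift compA; exact: (smap_r β).
  have hλ : invertible λ.
    have [s [sp ps]] := invertible_pr1 (PB (rleg e') (lleg p)) hp.
    exists (pr1 (PB (rleg e') (lleg p))); split; first exact: pr1_lift.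
    have -> : λ = s by rewrite -[λ]comp1m -sp -compA pr1_lift compm1.
    exact: sp.
  have [i hi] := span_map_iso (hλ :
    invertible (smap (@SpanMap _ _ _ b (span_comp PB p e') λ λl λr))).
  exists e', (@SpanMap _ _ _ e' e _ cl cr), i; rewrite hi.
  apply: span_map_ext; apply: pb_ext; rewrite /= ?(pr1_liftA, pr2_liftA).
    by rewrite -compA pr1_lift compm1.
  by rewrite -compA pr2_lift comp1m.
move=> e' e χ k; split.
  by move=> z; rewrite fmap_comp.
move=> x y exy.
have [|h hh] := @postcomp_full K X Y p hp k e' y.
  have := f_equal (fun m : span_map (span_comp PB p k) (span_comp PB p e) =>
    pr2 (PB (rleg e) (lleg p)) ∘ smap m) exy.
  by rewrite /= !pr2_liftA pr2_lift !comp1m.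
exists h; split; first split=> //.
  apply: (postcomp_faithful hp).
  by rewrite [RHS]exy -hh; exact: (fmap_comp (@postcomp (Spn PB) K X Y p) χ h).
move=> h' [_ e2]; apply: (postcomp_faithful hp).
by rewrite hh -e2.
Qed.

(** * Structural 2-cells of spans on generalized elements *)

Lemma hcomp_pr1 (X Y Z : C) (t t' : span Y Z) (s s' : span X Y)
    (β : span_map t t') (α : span_map s s') (V : C)
    (x : V ~> PB (rleg s) (lleg t)) :
  pr1 (PB (rleg s') (lleg t')) ∘ (smap (span_hcomp PB β α) ∘ x) = smap α ∘ (pr1 _ ∘ x).
Proof. by rewrite /= pr1_liftA compA. Qed.

Lemma hcomp_pr2 (X Y Z : C) (t t' : span Y Z) (s s' : span X Y)
    (β : span_map t t') (α : span_map s s') (V : C)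
    (x : V ~> PB (rleg s) (lleg t)) :
  pr2 (PB (rleg s') (lleg t')) ∘ (smap (span_hcomp PB β α) ∘ x) = smap β ∘ (pr2 _ ∘ x).
Proof. by rewrite /= pr2_liftA compA. Qed.

Lemma assoc_fwd_pr2 (X Y Z W : C) (w : span Z W) (t : span Y Z) (s : span X Y) (V : C)
    (x : V ~> PB (rleg s) (lleg (span_comp PB w t))) :
  pr2 (PB (rleg (span_comp PB t s)) (lleg w)) ∘ (smap (span_assoc_fwd PB w t s) ∘ x)
  = pr2 (PB (rleg t) (lleg w)) ∘ (pr2 _ ∘ x).
Proof. by rewrite /= pr2_liftA compA. Qed.

Lemma assoc_bwd_pr2 (X Y Z W : C) (w : span Z W) (t : span Y Z) (s : span X Y) (V : C)
    (x : V ~> PB (rleg (span_comp PB t s)) (lleg w)) (z : V ~> PB (rleg t) (lleg w)) :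
  pr1 _ ∘ z = pr2 (PB (rleg s) (lleg t)) ∘ (pr1 _ ∘ x) -> pr2 _ ∘ z = pr2 _ ∘ x ->
  pr2 (PB (rleg s) (lleg (span_comp PB w t))) ∘ (smap (span_assoc_bwd PB w t s) ∘ x) = z.
Proof.
move=> e1 e2; rewrite /= pr2_liftA; apply: pb_ext.
  by rewrite pr1_liftA e1 compA.
by rewrite pr2_liftA.
Qed.

(** * The bipullback built from an exponential over [T] *)

Section Exponential.

Variables (S Y T : C) (p : span S Y) (n : span T Y).
Hypothesis hp : invertible (lleg p).
Variables (P : C) (r : P ~> T).

Let Q := PB r (lleg n).

Variable ϖ : Q ~> apex p.
Hypothesis hϖ : rleg p ∘ ϖ = rleg n ∘ pr2 Q.

(* [P] over [T] represents the maps [V ×_T apex n -> apex p] over [Y]. The generalized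
   element [z] stands for the image of [x], so that no lift into [Q] has to be named. *)
Hypothesis transpose : forall (V : C) (t : V ~> T) (g : PB t (lleg n) ~> apex p),
  rleg p ∘ g = rleg n ∘ pr2 (PB t (lleg n)) ->
  exists b : V ~> P, r ∘ b = t /\
    forall (Z : C) (x : Z ~> PB t (lleg n)) (z : Z ~> Q),
      pr1 Q ∘ z = b ∘ (pr1 _ ∘ x) -> pr2 Q ∘ z = pr2 _ ∘ x -> ϖ ∘ z = g ∘ x.
(** The uniqueness half: [v] and the common second projection form an element of the pullback of
    [r ∘ b] and [lleg n], with images [z] and [z'] under [b] and [b']. *)
Hypothesis transpose_inj : forall (V : C) (b b' : V ~> P),
  r ∘ b = r ∘ b' ->
  (forall (Z : C) (v : Z ~> V) (z z' : Z ~> Q), pr1 Q ∘ z = b ∘ v -> pr1 Q ∘ z' = b' ∘ v ->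
    pr2 Q ∘ z = pr2 Q ∘ z' -> ϖ ∘ z = ϖ ∘ z') ->
  b = b'.

Definition exp_r : span P T := Span (idm P) r.
Definition exp_l : span P S := Span (pr1 Q) (lleg p ∘ ϖ).

Lemma exp_eq : rleg exp_l ∘ idm Q = lleg p ∘ ϖ.
Proof. by rewrite compm1. Qed.

Lemma exp_fwd_l :
  lleg (span_comp PB p exp_l) ∘ pb_lift _ exp_eq = lleg (span_comp PB n exp_r).
Proof. by rewrite /= -compA pr1_lift compm1 comp1m. Qed.

Lemma exp_fwd_r :
  rleg (span_comp PB p exp_l) ∘ pb_lift _ exp_eq = rleg (span_comp PB n exp_r).
Proof. by rewrite /= -compA pr2_lift hϖ. Qed.

Definition exp_fwd : span_map (span_comp PB n exp_r) (span_comp PB p exp_l) :=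
  @SpanMap _ _ _ (span_comp PB n exp_r) (span_comp PB p exp_l) _ exp_fwd_l exp_fwd_r.

(** The lift is a section of [pr1], which is invertible as a pullback of [lleg p]; hence [pr1]
    underlies the inverse of [exp_fwd]. *)
Lemma exp_fwd_pr1 :
  pb_lift _ exp_eq ∘ pr1 (PB (rleg exp_l) (lleg p)) = idm _.
Proof.
have [s [hs' hs]] := invertible_pr1 (PB (rleg exp_l) (lleg p)) hp.
by rewrite -[pb_lift _ _]comp1m -{1}hs' -(compA s) pr1_lift compm1.
Qed.

Lemma exp_bwd_l :
  lleg (span_comp PB n exp_r) ∘ pr1 (PB (rleg exp_l) (lleg p)) = lleg (span_comp PB p exp_l).
Proof. by rewrite -exp_fwd_l -compA exp_fwd_pr1 compm1. Qed.

Lemma exp_bwd_r :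
  rleg (span_comp PB n exp_r) ∘ pr1 (PB (rleg exp_l) (lleg p)) = rleg (span_comp PB p exp_l).
Proof. by rewrite -exp_fwd_r -compA exp_fwd_pr1 compm1. Qed.

Definition exp_bwd : span_map (span_comp PB p exp_l) (span_comp PB n exp_r) :=
  @SpanMap _ _ _ (span_comp PB p exp_l) (span_comp PB n exp_r) _ exp_bwd_l exp_bwd_r.

Lemma exp_bwd_fwd : span_map_comp exp_bwd exp_fwd = span_map_id _.
Proof. by apply: span_map_ext; rewrite /= pr1_lift. Qed.

Lemma exp_fwd_bwd : span_map_comp exp_fwd exp_bwd = span_map_id _.
Proof. by apply: span_map_ext; rewrite /= exp_fwd_pr1. Qed.

Definition exp_iso : @iso (span_cat P Y) (span_comp PB n exp_r) (span_comp PB p exp_l) :=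
  @Iso (span_cat P Y) _ _ exp_fwd exp_bwd exp_bwd_fwd exp_fwd_bwd.

Section Comparison.

Variable K : C.

Let cmp (W : span K P) :
    span_map (span_comp PB n (span_comp PB exp_r W)) (span_comp PB p (span_comp PB exp_l W)) :=
  fwd (pciso (@comparison_ob (Spn PB) P T S Y exp_r exp_l n p exp_iso K W)).

(** The associators only rearrange components, so the projection to [apex p] is computed by
    [exp_fwd], that is, by [ϖ]. This turns compatibility with the comparison 2-cells into equations
    about [ϖ]. *)
Lemma comparison_pr2 (W : span K P) (Z : C)
    (x : Z ~> PB (rleg (span_comp PB exp_r W)) (lleg n)) (z : Z ~> Q) :
  pr1 Q ∘ z = pr2 (PB (rleg W) (idm P)) ∘ (pr1 _ ∘ x) -> pr2 Q ∘ z = pr2 _ ∘ x ->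
  pr2 (PB (rleg (span_comp PB exp_l W)) (lleg p)) ∘ (smap (cmp W) ∘ x) = ϖ ∘ z.
Proof.
move=> e1 e2.
have -> : smap (cmp W) ∘ x = smap (span_assoc_fwd PB p exp_l W) ∘
    (smap (span_hcomp PB exp_fwd (span_map_id W)) ∘ (smap (span_assoc_bwd PB n exp_r W) ∘ x)).
  by symmetry; etransitivity; [exact: (f_equal (comp _) (compA _ _ _)) | exact: compA].
rewrite assoc_fwd_pr2 hcomp_pr2 (@assoc_bwd_pr2 _ _ _ _ n exp_r W _ x z e1 e2).
by rewrite compA /= pr2_lift.
Qed.

(** By [transpose_inj], compatibility with [t] forces [s] to preserve the projection to [P], so [s]
    comes from some [f] by [postcomp_full]; then [t] is determined by [s]. *)
Lemma comparison_full (W W' : span K P)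
    (s : span_map (span_comp PB exp_r W) (span_comp PB exp_r W'))
    (t : span_map (span_comp PB exp_l W) (span_comp PB exp_l W')) :
  span_map_comp (span_hcomp PB (span_map_id p) t) (cmp W)
  = span_map_comp (cmp W') (span_hcomp PB (span_map_id n) s) ->
  exists f : span_map W W', span_hcomp PB (span_map_id exp_r) f = s /\
    span_hcomp PB (span_map_id exp_l) f = t.
Proof.
move=> est.
have eb : pr2 (PB (rleg W') (idm P)) ∘ smap s = pr2 (PB (rleg W) (idm P)).
  apply: transpose_inj; first by rewrite !compA; exact: (smap_r s).
  move=> Z v z z' ez ez' ezz'.
  (* The element [x] has components [v] and [pr2 Q ∘ z']; [comparison_pr2] yields [ϖ ∘ z'] at [x]
     and [ϖ ∘ z] at its image under [s]. *)
  have ex : rleg (span_comp PB exp_r W) ∘ v = lleg n ∘ (pr2 Q ∘ z').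
    by rewrite -pb_squareA ez' compA.
  pose x := pb_lift (PB (rleg (span_comp PB exp_r W)) (lleg n)) ex.
  have x1 : pr1 (PB (rleg (span_comp PB exp_r W)) (lleg n)) ∘ x = v by exact: pr1_lift.
  have x2 : pr2 (PB (rleg (span_comp PB exp_r W)) (lleg n)) ∘ x = pr2 Q ∘ z'.
    exact: pr2_lift.
  have c := @comparison_pr2 W Z x z'.
  have c' := @comparison_pr2 W' Z (smap (span_hcomp PB (span_map_id n) s) ∘ x) z.
  rewrite hcomp_pr1 hcomp_pr2 comp1m x1 x2 in c'.
  rewrite x1 x2 in c.
  rewrite -compA in ez.
  rewrite -(c ez' erefl) -(c' ez ezz').
  rewrite -[RHS]comp1m.
  rewrite -[RHS](@hcomp_pr2 _ _ _ p p _ _ (span_map_id p) t).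
  congr (_ ∘ _); rewrite [LHS]compA [RHS]compA; congr (_ ∘ _).
  exact: (esym (f_equal (@smap _ _ _ _ _) est)).
have [f hf] := @postcomp_full K P T exp_r (invertible_idm P) W W' s eb.
exists f; split=> //.
(* After whiskering with [p] and precomposing with [cmp W], both sides equal [cmp W'] after the
   whiskering of [s]: one by [est], the other by naturality of the comparison. *)
apply: (postcomp_faithful hp).
apply: (iso_epi (i := pciso (@comparison_ob (Spn PB) P T S Y exp_r exp_l n p exp_iso K W))).
rewrite [RHS]est -hf.
exact: (pch_comm (@comparison_hom (Spn PB) P T S Y exp_r exp_l n p exp_iso K W W' f)).
Qed.

(** The [apex p] component of [α] transposes to a map [b] into [P], the right leg of [W]. The first
    projection gives [exp_r ⊙ W ≅ V1]; the isomorphism to [V2] is then lifted through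
    postcomposition with [p]. *)
Lemma comparison_essurj (o : pcomma (@postcomp (Spn PB) K T Y n) (@postcomp (Spn PB) K S Y p)) :
  exists W : span K P,
    inhabited (comparison (M := Spn PB) (d := exp_r) (c := exp_l) (n := n) (p := p) exp_iso K W
      ≅ o).
Proof.
case: o => V1 V2 α.
pose a : span_map (span_comp PB n V1) (span_comp PB p V2) := fwd α.
have eg : rleg p ∘ (pr2 (PB (rleg V2) (lleg p)) ∘ smap a)
    = rleg n ∘ pr2 (PB (rleg V1) (lleg n)).
  by rewrite compA; exact: (smap_r a).
have [b [rb tb]] := transpose eg.
pose W : span K P := Span (lleg V1) b.
have s0l : lleg V1 ∘ pr1 (PB (rleg W) (idm P)) = lleg (span_comp PB exp_r W) by [].
have s0r : rleg V1 ∘ pr1 (PB (rleg W) (idm P)) = rleg (span_comp PB exp_r W).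
  by rewrite -rb /= -!compA pb_square comp1m.
pose s0 := @SpanMap _ _ _ (span_comp PB exp_r W) V1 _ s0l s0r.
have [s hs] := span_map_iso
  (invertible_pr1 (PB (rleg W) (idm P)) (invertible_idm P) : invertible (smap s0)).
pose ns : @iso (span_cat K Y) (span_comp PB n (span_comp PB exp_r W)) (span_comp PB n V1) :=
  functor_iso (@postcomp (Spn PB) K T Y n) s.
pose cW : @iso (span_cat K Y) _ _ :=
  pciso (@comparison_ob (Spn PB) P T S Y exp_r exp_l n p exp_iso K W).
(* The compatibility square forces this value on the whiskering by [p] of the second component. *)
pose f : @iso (span_cat K Y) (span_comp PB p (span_comp PB exp_l W)) (span_comp PB p V2) :=
  iso_trans (X := span_cat K Y) (iso_trans (X := span_cat K Y) α ns) (iso_sym cW).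
have fc : span_map_comp (fwd f) (cmp W) = span_map_comp a (span_hcomp PB (span_map_id n) (fwd s)).
  transitivity (span_map_comp (span_map_comp a (fwd ns)) (span_map_comp (bwd cW) (fwd cW))).
    by symmetry; exact: (@compA (span_cat K Y)).
  by rewrite (bwd_fwd cW : span_map_comp _ _ = _); exact: (@compm1 (span_cat K Y)).
have ef : pr2 (PB (rleg V2) (lleg p)) ∘ smap (fwd f)
    = pr2 (PB (rleg (span_comp PB exp_l W)) (lleg p)).
  (* Cancelling [cmp W] allows [comparison_pr2] to reduce one side to [ϖ], and the transposition
     equation [tb] gives the other. *)
  have hc : invertible (smap (cmp W)).
    exists (smap (bwd cW)); split.
      exact: (f_equal (@smap _ _ _ _ _) (bwd_fwd cW)).
    exact: (f_equal (@smap _ _ _ _ _) (fwd_bwd cW)).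
  apply: (invertible_epi hc).
  transitivity (pr2 (PB (rleg V2) (lleg p)) ∘
      (smap a ∘ smap (span_hcomp PB (span_map_id n) (fwd s)))).
    rewrite -[LHS]compA; congr (_ ∘ _).
    exact: (f_equal (@smap _ _ _ _ _) fc).
  have ez : r ∘ (pr2 (PB (rleg W) (idm P)) ∘ pr1 (PB (rleg (span_comp PB exp_r W)) (lleg n)))
      = lleg n ∘ pr2 _.
    by rewrite -pb_square /= compA.
  have z1 := pr1_lift Q ez; have z2 := pr2_lift Q ez.
  have c := @comparison_pr2 W _ (idm _) (pb_lift Q ez).
  rewrite !compm1 in c.
  rewrite (c z1 z2).
  have u1 : pr1 Q ∘ pb_lift Q ez
      = b ∘ (pr1 (PB (rleg V1) (lleg n)) ∘ smap (span_hcomp PB (span_map_id n) (fwd s))).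
    rewrite z1 -[smap (span_hcomp _ _ _)]compm1 hcomp_pr1 hs compm1 /= compA.
    by rewrite pb_square comp1m.
  have u2 : pr2 Q ∘ pb_lift Q ez
      = pr2 (PB (rleg V1) (lleg n)) ∘ smap (span_hcomp PB (span_map_id n) (fwd s)).
    by rewrite z2 -[smap (span_hcomp _ _ _)]compm1 hcomp_pr2 comp1m compm1.
  by rewrite (tb _ _ _ u1 u2) -compA.
have [t ht] := postcomp_full_iso hp ef.
exists W; apply: (@pcomma_iso _ _ _ (@postcomp (Spn PB) K T Y n) (@postcomp (Spn PB) K S Y p)
  (@comparison_ob (Spn PB) P T S Y exp_r exp_l n p exp_iso K W) (PcommaOb α) s t).
exact: (etrans (f_equal (fun m => span_map_comp m (cmp W)) ht) fc).
Qed.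

End Comparison.

Lemma exp_bipullback :
  is_bipullback (M := Spn PB) (d := exp_r) (c := exp_l) (n := n) (p := p) exp_iso.
Proof.
move=> K; apply: fully_faithful_essurj_equivalence.
(* The first component alone is faithful, since the left leg of [exp_r] is an identity. *)
- move=> W W' f g e; apply: (@postcomp_faithful K P T exp_r (invertible_idm P) W W').
  exact: (f_equal (@pch1 _ _ _ _ _ _ _) e).
- move=> W W' h.
  have [f [fs ft]] := comparison_full (pch_comm h).
  by exists f; apply: pcomma_hom_ext.
- exact: comparison_essurj.
Qed.

End Exponential.

(** * Exponentials from right lifters *)

Section RightLifter.

Variables (One : C) (bang : forall x : C, x ~> One).
Hypothesis bang_uniq : forall (x : C) (f g : x ~> One), f = g.

(** Left legs into the terminal object carry no information, so 2-cells of spans from [One] are maps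
    over the target. Existence in the right lifting property gives [transpose], uniqueness gives
    [transpose_inj]. *)
Lemma right_lifter_bipullback (S Y T : C) (p : span S Y) (n : span T Y) :
  is_right_lifter (n : bhom (T : Spn PB) Y) -> invertible (lleg p) ->
  exists (P : Spn PB) (n' : bhom P S) (p' : bhom P T)
    (θ : (n : bhom (T : Spn PB) Y) ⊙ p' ≅ (p : bhom (S : Spn PB) Y) ⊙ n'),
    is_bipullback θ /\ invertible (lleg p').
Proof.
move=> hn hp.
have [R [ϖ hR]] := hn One (Span (bang (apex p)) (rleg p)).
pose P := apex R; pose r : P ~> T := rleg R.
have hϖ : rleg p ∘ smap ϖ = rleg n ∘ pr2 (PB r (lleg n)) by exact: (smap_r ϖ).
exists P, (@exp_l S Y T p n P r (smap ϖ)), (@exp_r T P r),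
  (@exp_iso S Y T p n hp P r (smap ϖ) hϖ).
split; last exact: invertible_idm.
apply: exp_bipullback.
- move=> V t g eg.
  pose v : span One T := Span (bang V) t.
  pose τ := @SpanMap _ _ _ (span_comp PB n v) (Span (bang (apex p)) (rleg p)) g
    (bang_uniq _ _) eg.
  have [σ [hσ _]] := hR v τ.
  exists (smap σ); split; first exact: (smap_r σ).
  move=> Z x z e1 e2.
  rewrite -[g](f_equal (@smap _ _ _ _ _) hσ :
    smap ϖ ∘ smap (span_hcomp PB (span_map_id n) σ) = g).
  rewrite -compA; congr (_ ∘ _); apply: pb_ext.
    exact: (etrans e1 (esym (hcomp_pr1 (span_map_id n) σ x))).
  by rewrite e2; symmetry; etransitivity; [exact: (hcomp_pr2 (span_map_id n) σ x) | exact: comp1m].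
- move=> V b b' er hb.
  pose v : span One T := Span (bang V) (r ∘ b).
  pose σ := @SpanMap _ _ _ v R b (bang_uniq _ _) erefl.
  pose σ' := @SpanMap _ _ _ v R b' (bang_uniq _ _) (esym er).
  (* By [hb], [σ] and [σ'] have the same pasting with [ϖ], so both equal the unique solution [m]. *)
  have [m [_ um]] := hR v (span_map_comp ϖ (span_hcomp PB (span_map_id n) σ)).
  have e : m = σ by exact: um.
  have e' : m = σ'.
    apply: um; apply: span_map_ext; symmetry.
    apply: (hb _ (pr1 (PB (rleg v) (lleg n))) (smap (span_hcomp PB (span_map_id n) σ))
      (smap (span_hcomp PB (span_map_id n) σ')));
      [exact: pr1_lift | exact: pr1_lift | by rewrite /= !pr2_lift].
  by have := f_equal (@smap _ _ _ _ _) (etrans (esym e) e').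
Qed.

End RightLifter.

End Spans.

Theorem proposition16 (C : category) (hC : has_finite_limits C) (PB : chosen_pullbacks C) :
  polynomic (Spn PB).
Proof.
split.
- move=> A B f hf; apply: lleg_invertible_fibration.
  exact: equivalence_lleg_invertible hf.
- move=> A B f g i hf; apply: lleg_invertible_fibration.
  exact: span_iso_lleg i (fibration_lleg_invertible hf).
- move=> A B D p q /fibration_lleg_invertible hp.
  (* The left leg of [p ⊙ q] is [lleg q] composed with this invertible projection. *)
  have hpr : invertible (pr1 (PB _ _ _ (rleg q) (lleg p))) by exact: invertible_pr1.
  split=> /fibration_lleg_invertible h; apply: lleg_invertible_fibration.
    exact: invertible_compr hpr h.
  exact: invertible_comp h hpr.
- by [].
- move=> S Y T p n hn /fibration_lleg_invertible hp.
  have [One [[bang] uniq]] := has_finite_limits_terminal hC.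
  have [P [n' [p' [θ [hθ h']]]]] := right_lifter_bipullback bang uniq hn hp.
  exists P, n', p', θ; split=> //.
  exact: lleg_invertible_fibration.
Qed.
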